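(* Let $d\geq 2$, let $F_d$ be the free group on $d$ standard generators, and let $X$ be the Cantor set. Then every orbit in $\mathrm{A}^*(F_d,X)$ under the conjugation action of the homeomorphism group of $X$ is meagre in $\mathrm{A}^*(F_d,X)$.
   Context: Actions are by homeomorphisms. $\mathrm{Act}(F_d,X)$ is the set of all actions $F_d\curvearrowright X$ with the (Polish) topology of elementwise uniform convergence: fixing a compatible metric $d_X$ on $X$, a basis is given by the sets $\{\beta : \sup_{x\in X} d_X(\beta_s x,\alpha_s x)<\delta \text{ for all } s\in E\}$ for $\alpha\in\mathrm{Act}(F_d,X)$, $E\subseteq F_d$ finite, $\delta>0$. A homeomorphism $g$ of $X$ sends an action $\alpha$ to the action $s\mapsto g\circ\alpha_s\circ g^{-1}$. A homeomorphism $T:X\to X$ is strictly ergodic if it is minimal and has a unique invariant Borel probability measure, and spectrally aperiodic if there are no clopen set $A\subseteq X$ and integer $n\geq 1$ such that the sets $A,TA,\dots,T^nA$ partition $X$. $\mathrm{A}^*(F_d,X)\subseteq\mathrm{Act}(F_d,X)$, with the subspace topology, is the set of actions that are topologically free (the set of points with trivial stabilizer is dense), admit an $F_d$-invariant Borel probability measure, and are such that each standard generator acts as a strictly ergodic and spectrally aperiodic homeomorphism. *)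

(* Defs.v *)
From HB Require Import structures.
From mathcomp Require Import all_boot.
From mathcomp Require Import all_classical all_reals all_analysis.

Set Implicit Arguments.
Unset Strict Implicit.
Unset Printing Implicit Defensive.

Local Open Scope classical_set_scope.

(** The free group [F_d] is the type of reduced words in the letters
    [(i, false)] (the [i]-th generator) and [(i, true)] (its inverse), with
    concatenation followed by free reduction as multiplication. *)

Notation letter d := ('I_d * bool)%type.

Definition linv d (a : letter d) : letter d := (a.1, ~~ a.2).

Definition nocancel d (a b : letter d) : bool := b != linv a.

Definition reduced d (w : seq (letter d)) : bool := sorted (@nocancel d) w.

Record free_group (d : nat) : Type := FreeGroup {
  fg_word :> seq (letter d);
  fg_reduced : reduced fg_word }.

HB.instance Definition _ d := [isSub for @fg_word d].
HB.instance Definition _ d := [Choice of free_group d by <:].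

Section FreeGroupLaws.
Variable d : nat.
Implicit Types (a b : letter d) (u v w : seq (letter d)).

Definition push a w : seq (letter d) :=
  if w is b :: w' then if b == linv a then w' else a :: w else [:: a].

Definition wmul u v : seq (letter d) := foldr push v u.

Definition winv u : seq (letter d) := rev (map (@linv d) u).

Lemma linvK : involutive (@linv d).
Proof. by case=> i e; rewrite /linv /= negbK. Qed.

Lemma reduced_push a w : reduced w -> reduced (push a w).
Proof.
case: w => [|b w] //= rw; case: ifPn => [_|nab]; last by rewrite /= /nocancel nab.
exact: path_sorted rw.
Qed.

Lemma reduced_wmul u v : reduced v -> reduced (wmul u v).
Proof. by move=> rv; elim: u => //= a u; exact: reduced_push. Qed.

Lemma pushK a w : reduced w -> push (linv a) (push a w) = w.
Proof.
case: w => [|b w] /= rw; first by rewrite linvK eqxx.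
case: ifPn => [/eqP ba|_]; last by rewrite /= linvK eqxx.
case: w rw => [|c w] /=; first by rewrite ba.
by rewrite ba /nocancel => /andP[/negPf -> _].
Qed.

Lemma wmul_push a u v : reduced v -> wmul (push a u) v = push a (wmul u v).
Proof.
move=> rv; case: u => [|b u] //=; case: ifPn => [/eqP -> |//].
by rewrite -[in RHS](linvK a) linvK -{1}(linvK a) pushK // reduced_wmul.
Qed.

Lemma wmulA u v w : reduced w -> wmul u (wmul v w) = wmul (wmul u v) w.
Proof. by move=> rw; elim: u => //= a u ->; rewrite wmul_push. Qed.

Lemma wmul0 u : reduced u -> wmul u [::] = u.
Proof.
elim: u => //= a u IH au; rewrite IH; last exact: path_sorted au.
by case: u au {IH} => //= b u /andP[/negPf ->].
Qed.

Lemma reduced_winv u : reduced u -> reduced (winv u).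
Proof.
rewrite /reduced /winv rev_sorted sorted_map; congr is_true.
case: u => //= a u; elim: u a => //= b u IH a; rewrite IH; congr andb.
rewrite /nocancel /relpre /= linvK; congr negb.
by apply/eqP/eqP => [->|->]; rewrite ?linvK.
Qed.

Lemma winvK : involutive winv.
Proof.
by move=> u; rewrite /winv map_rev revK -map_comp map_id_in // => a _; exact: linvK.
Qed.

Lemma wmulV u v : reduced v -> wmul (winv u) (wmul u v) = v.
Proof.
elim: u v => //= a u IH v rv.
rewrite /winv /= rev_cons -cats1 /wmul foldr_cat /= pushK; first exact: IH.
exact: reduced_wmul.
Qed.

Definition fg_mul (x y : free_group d) : free_group d :=
  FreeGroup (reduced_wmul x (fg_reduced y)).

Definition fg_one : free_group d := @FreeGroup d [::] isT.

Definition fg_inv (x : free_group d) : free_group d :=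
  FreeGroup (reduced_winv (fg_reduced x)).

Lemma fg_mulA : associative fg_mul.
Proof. by move=> x y z; apply: val_inj; rewrite /= wmulA ?fg_reduced. Qed.

Lemma fg_mul1 : left_id fg_one fg_mul.
Proof. by move=> x; exact: val_inj. Qed.

Lemma fg_mulr1 : right_id fg_one fg_mul.
Proof. by move=> x; apply: val_inj; rewrite /= wmul0 ?fg_reduced. Qed.

Lemma fg_mulV : left_inverse fg_one fg_inv fg_mul.
Proof.
by move=> x; apply: val_inj; rewrite /= -[X in wmul _ X]wmul0 ?fg_reduced ?wmulV.
Qed.

Lemma fg_mulrV : right_inverse fg_one fg_inv fg_mul.
Proof.
move=> x; rewrite -[x in fg_mul x _](_ : fg_inv (fg_inv x) = x) ?fg_mulV //.
by apply: val_inj; exact: winvK.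
Qed.

End FreeGroupLaws.

HB.instance Definition _ d := isGroup.Build (free_group d)
  (@fg_mulA d) (@fg_mul1 d) (@fg_mulr1 d) (@fg_mulV d) (@fg_mulrV d).

Definition fgen d (i : 'I_d) : free_group d := @FreeGroup d [:: (i, false)] isT.

Definition homeo_with_inverse (X Y : topologicalType) (g : X -> Y) (h : Y -> X) :=
  [/\ continuous g, continuous h, cancel g h & cancel h g].

Definition homeomorphism (X Y : topologicalType) (g : X -> Y) : Prop :=
  exists h, homeo_with_inverse g h.

Definition nowhere_dense (T : topologicalType) (A : set T) : Prop :=
  interior (closure A) = set0.

Definition meagre (T : topologicalType) (A : set T) : Prop :=
  exists F : nat -> set T,
    (forall n, nowhere_dense (F n)) /\ A = \bigcup_n F n.

(** Families of self-maps of [X] indexed by [F_d], with the topology of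
    elementwise uniform convergence. On a compact Hausdorff [X] the uniformity
    is the one induced by any compatible metric. *)
Definition elementwise (d : nat) (X : uniformType) : Type :=
  {ptws free_group d -> {uniform X -> X}}.

HB.instance Definition _ d (X : uniformType) := Uniform.on (elementwise d X).

Definition Act (d : nat) (X : uniformType) : set (elementwise d X) :=
  [set alpha : elementwise d X |
    [/\ forall s, homeomorphism (alpha s : X -> X),
        forall x : X, alpha 1%g x = x &
        forall s t (x : X), alpha (s * t)%g x = alpha s (alpha t x)]].

Lemma elementwise_nbhsP d (X : uniformType) (alpha : elementwise d X)
    (U : set (elementwise d X)) :
  nbhs alpha U <->
  exists (E : seq (free_group d)) (V : set (X * X)), entourage V /\
    [set beta : elementwise d X |
       forall s, s \in E -> forall x : X, V (alpha s x, beta s x)] `<=` U.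
Proof.
split; last first.
  move=> [E [V [entV sub]]]; apply: filterS sub _; elim: E => [|s E IH].
    by apply: filterS filterT => beta _ s; rewrite in_nil.
  have Hs : nbhs alpha [set beta : elementwise d X |
      forall x : X, V (alpha s x, beta s x)].
    apply: (@proj_continuous _ (fun=> {uniform X -> X}) s alpha
      [set f | forall x, V (alpha s x, f x)]).
    by apply/uniform_nbhs; exists V; split=> // f + x; exact.
  apply: filterS2 Hs IH => beta Hs IH t; rewrite in_cons => /predU1P[->|/IH] //.
pose G : set_system (elementwise d X) := [set W |
  exists (E : seq (free_group d)) (V : set (X * X)), entourage V /\
    [set beta : elementwise d X |
       forall s, s \in E -> forall x : X, V (alpha s x, beta s x)] `<=` W].
have FG : Filter G.
  split.
  - by exists [::], setT; split=> //; exact: filterT.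
  - move=> P Q [E [V [entV sP]]] [E' [V' [entV' sQ]]].
    exists (E ++ E'), (V `&` V'); split; first exact: filterI.
    move=> beta H; split; [apply: sP|apply: sQ] => s sE x;
      by have [] := H s _ x; rewrite ?mem_cat ?sE ?orbT.
  - move=> P Q PQ [E [V [entV sP]]]; exists E, V; split=> //.
    exact: subset_trans PQ.
suff : G --> alpha by exact.
apply/cvg_sup => s W [Q [[B oB <-] Bs sW]].
have /uniform_nbhs[V [entV sV]] : nbhs (alpha s : {uniform X -> X}) B.
  exact: open_nbhs_nbhs.
exists [:: s], V; split=> // beta H; apply: sW; apply: sV => x _.
by apply: H; rewrite mem_head.
Qed.

Arguments Act : clear implicits.

Section Dynamics.
Context {X : topologicalType}.
Implicit Types (T : X -> X).

Definition minimal T : Prop :=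
  forall C : set X, closed C -> T @` C = C -> C = set0 \/ C = setT.

Definition spectrally_aperiodic T : Prop :=
  ~ exists (A : set X) (n : nat), [/\ clopen A, (1 <= n)%N,
      trivIset [set k | (k <= n)%N] (fun k => iter k T @` A) &
      \bigcup_(k in [set k | (k <= n)%N]) (iter k T @` A) = setT].

End Dynamics.

Definition borel (X : ptopologicalType) : measurableType _ :=
  g_sigma_algebraType (@open X).

Definition invariant_prob (R : realType) (X : ptopologicalType) (T : X -> X)
    (mu : probability (borel X) R) : Prop :=
  forall A : set (borel X), measurable A -> mu (T @^-1` A) = mu A.

(** Measures are compared on measurable sets only, since their values elsewhere
    carry no information. *)
Definition strictly_ergodic (R : realType) (X : ptopologicalType)
    (T : X -> X) : Prop :=
  minimal T /\
  exists mu : probability (borel X) R, invariant_prob T mu /\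
    forall nu : probability (borel X) R, invariant_prob T nu ->
      forall A : set (borel X), measurable A -> nu A = mu A.

Definition topologically_free d (X : uniformType) (alpha : elementwise d X) :=
  dense [set x : X | forall s, alpha s x = x -> s = 1%g].

(** The subspace topology on this set is the library's topology on its
    [set_type]. *)
Definition Astar (R : realType) (d : nat) (X : puniformType) :
    set (elementwise d X) :=
  [set alpha : elementwise d X |
    [/\ Act d X alpha,
        topologically_free alpha,
        exists mu : probability (borel X) R,
          forall s, invariant_prob (alpha s : X -> X) mu &
        forall i : 'I_d, strictly_ergodic R (alpha (fgen i) : X -> X) /\
                         spectrally_aperiodic (alpha (fgen i) : X -> X)]].

Arguments Astar : clear implicits.

Definition conj_orbit d (X : uniformType) (alpha : elementwise d X) :
    set (elementwise d X) :=
  [set beta : elementwise d X | exists (g h : X -> X),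
     homeo_with_inverse g h /\
     forall s (x : X), beta s x = g (alpha s (h x))].

(* Main.v *)
(** Let [a], [b] be the first two generators. For a clopen set [A], an action
    [beta] has a numerical invariant: the maximal number of visits, over
    [b]-orbit segments of length [N], to the set of points [x] with
    [b^m x \in A] and [a^n x \in A]. It is locally constant in [beta], and
    conjugating by [g] replaces [A] by [g A]. As there are countably many clopen
    sets, it suffices to show that these invariants, for a fixed proper clopen
    [A], are constant on no open subset of A*; so every [alpha] must be perturbed
    within A* so as to change one of them.

    Take a small clopen [Q] inside [A]. Spectral aperiodicity gives [m], [n] such
    that neither [B = b^-m A] nor [C = a^-n A] is trivial on [Q]. The minimality
    of [a] provides a clopen [D] in [Q] and [k] such that [a^k D] lies in [Q], and
    the involution [h] exchanging [D] and [a^k D] either removes [D] from the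
    intersection of [B] and [h C] or adds it. The perturbed action has [h a h] in
    place of [a] and the other generators unchanged. It lies in A*: strict
    ergodicity and spectral aperiodicity are conjugacy invariant; [h], being
    piecewise a power of [a], preserves the invariant measure; and at a point with
    trivial stabilizer each syllable [h a^n h] moves like a nonzero power of [a],
    so nontrivial reduced words still act without fixing the point. *)

Require Import Defs.
From HB Require Import structures.
From mathcomp Require Import all_boot finmap zify.
From mathcomp Require Import all_classical all_reals all_analysis.

Set Implicit Arguments.
Unset Strict Implicit.
Unset Printing Implicit Defensive.

Local Open Scope classical_set_scope.

(** * Uniformities and clopen sets in compact spaces *)

(** A Lebesgue number argument: finitely many balls of half size cover the space, and the
    intersection of their half-size entourages keeps both points in one full-size ball. *)
Lemma compact_local_entourage (X : puniformType) (P : X -> X -> Prop) :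
  compact [set: X] ->
  (forall x, exists2 N : set X, nbhs (x : X) N & forall y z, N y -> N z -> P y z) ->
  entourage [set yz : X * X | P yz.1 yz.2].
Proof.
move=> cX locP.
have entP x : exists2 E : set (X * X), entourage E &
    forall y z, E (x, y) -> E (x, z) -> P y z.
  have [N + NP] := locP x; rewrite -nbhs_entourageE => -[E entE EN].
  by exists E => // y z xy xz; apply: NP; apply: EN; apply/mem_set.
pose E x := projT1 (cid2 (entP x)).
have entE x : entourage (E x) by rewrite /E; case: cid2.
have EP x y z : E x (x, y) -> E x (x, z) -> P y z.
  by rewrite /E; case: cid2 => E' _ /=; exact.
pose S x := split_ent (E x).
have entS x : entourage (S x) by exact: entourage_split_ent.
move: cX; rewrite compact_cover.
move=> /(_ X setT (fun x => interior (xsection (S x) x))) [].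
- by move=> x _; exact: open_interior.
- by move=> x _; exists x => //; exact: nbhs_entourage.
move=> D _ cov.
have : entourage (\bigcap_(x in [set` D]) S x) by exact: filter_bigI.
apply: filterS => -[y z] /= Syz.
have [x /= xD /interior_subset/xsectionP xy] := cov y I.
apply: (EP x); first exact: split_ent_subset (entE x) _ xy.
exact: entourage_split (entE x) xy (Syz x xD).
Qed.

Lemma compact_unif_continuous (X : puniformType) (f : X -> X) (V : set (X * X)) :
  compact [set: X] -> continuous f -> entourage V ->
  entourage [set yz : X * X | V (f yz.1, f yz.2)].
Proof.
move=> cX cf entV.
apply: (@compact_local_entourage X (fun y z => V (f y, f z))) => // x.
pose W := split_ent V.
have entW : entourage W by exact: entourage_split_ent.
exists (f @^-1` xsection (W `&` W^-1)%relation (f x)).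
  by apply: cf; apply: nbhs_entourage; exact: entourage_invI.
move=> y z /= /xsectionP[_ yx] /xsectionP[xz _].
exact: entourage_split entV yx xz.
Qed.

(** Membership in a clopen set is locally constant. This is the source of the local constancy of the
    invariants. *)
Lemma clopen_entourage (X : puniformType) (A : set X) :
  compact [set: X] -> clopen A -> entourage [set yz : X * X | A yz.1 <-> A yz.2].
Proof.
move=> cX [oA cA].
apply: (@compact_local_entourage X (fun y z => A y <-> A z)) => // x.
have [Ax|nAx] := pselect (A x).
  by exists A => //; exact: open_nbhs_nbhs.
exists (~` A) => //; apply: open_nbhs_nbhs; split=> //; exact: closed_openC.
Qed.

Lemma clopen_forall_lt (X : topologicalType) (n : nat) (F : nat -> set X) :
  (forall i, clopen (F i)) -> clopen [set x | forall i, (i < n)%N -> F i x].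
Proof.
move=> cF; elim: n => [|n IH].
  by rewrite (_ : [set x | _] = setT); [exact: clopenT|apply/seteqP; split].
rewrite (_ : [set x | _] = F n `&` [set x | forall i, (i < n)%N -> F i x]).
  exact: clopenI.
apply/seteqP; split=> [x Fx|x [Fnx Fx] i]; first by split=> [|i ?]; apply: Fx; lia.
by rewrite ltnS leq_eqVlt => /predU1P[->//|]; exact: Fx.
Qed.

(** * Minimal homeomorphisms and itineraries *)

Lemma continuous_iter (X : topologicalType) (T : X -> X) (n : nat) :
  continuous T -> continuous (iter n T).
Proof.
by move=> cT; elim: n => [|n IH] x //=; apply: continuous_comp; [exact: IH|exact: cT].
Qed.

Lemma iter_cancel (X : Type) (T T' : X -> X) (n : nat) :
  cancel T T' -> cancel (iter n T) (iter n T').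
Proof. by move=> TK; elim: n => [|n IH] x //=; rewrite -iterS iterSr TK IH. Qed.

Lemma iter_cancel_sub (X : Type) (T T' : X -> X) (m n : nat) (x : X) :
  cancel T T' -> (m <= n)%N -> iter m T' (iter n T x) = iter (n - m) T x.
Proof. by move=> TK mn; rewrite -[in LHS](subnKC mn) iterD iter_cancel. Qed.

Section MinimalHomeomorphism.
Variables (X : ptopologicalType) (T T' : X -> X).
Hypotheses (cX : compact [set: X]) (homT : homeo_with_inverse T T')
  (minT : minimal T).

(** The union [O] of the translates of [U] under all integer powers of [T] is open and invariant, so
    it is everything by minimality, and finitely many translates suffice by compactness. *)
Lemma minimal_syndetic (U : set X) : open U -> U !=set0 ->
  exists L, forall x, exists2 k, (k <= L)%N & U (iter k T x).
Proof.
move=> oU [u Uu]; have [cT cT' TK T'K] := homT.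
pose P (i : nat * bool) := iter i.1 (if i.2 then T else T') @^-1` U.
have oP i : open (P i).
  apply: open_comp => // x _; apply: continuous_iter.
  by case: (i.2).
pose O := \bigcup_i P i.
have OT x : O (T x) <-> O x.
  split=> -[[k []] _]; rewrite /P /preimage /=.
  - by move=> Ux; exists (k.+1, true); rewrite // /P /preimage /= -iterS iterSr.
  - case: k => [Ux|k]; first by exists (1%N, true).
    by rewrite iterSr TK => Ux; exists (k, false).
  - case: k => [Ux|k]; first by exists (1%N, false); rewrite // /P /preimage /= TK.
    by rewrite iterSr => Ux; exists (k, true).
  - by move=> Ux; exists (k.+1, false); rewrite // /P /preimage /= -iterS iterSr TK.
have : closed (~` O) by rewrite closedC; exact: bigcup_open.
move=> /minT[].
- apply/seteqP; split=> [_ [x Ox <-] /OT //|x Ox].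
  by exists (T' x); rewrite ?T'K // => Ox'; apply: Ox; rewrite -[x]T'K; apply/OT.
- move=> /(congr1 (@setC X)); rewrite setCK setC0 => OE.
  move: cX; rewrite compact_cover => /(_ _ setT P) [].
  + by move=> i _; exact: oP.
  + by rewrite -OE.
  (* The cover gives times between [-M] and [M]; starting from the [M]-th iterate of [x] makes them
     nonnegative. *)
  move=> D _ cov; pose M := \max_(i <- D) i.1; exists (M + M)%N => x.
  have [[k e] /= kD] := cov (iter M T x) I.
  have kM : (k <= M)%N by exact: (leq_bigmax_seq (F := fun i => i.1) (k, e) kD).
  case: e kD => kD; rewrite /P /preimage /=.
    by rewrite -iterD => Ux; exists (k + M)%N => //; rewrite leq_add2r.
  by rewrite iter_cancel_sub // => Ux; exists (M - k)%N => //; lia.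
- by move=> OE; have : (~` O) u; [rewrite OE|case; exists (0%N, true)].
Qed.

Lemma minimal_backward (U : set X) : open U -> U !=set0 ->
  forall z, exists k q, U q /\ z = iter k T q.
Proof.
have [_ _ TK T'K] := homT.
move=> oU U0 z; have [L LU] := minimal_syndetic oU U0.
have [k kL Uk] := LU (iter L T' z).
exists (L - k)%N, (iter k T (iter L T' z)); split=> //.
by rewrite -iterD subnK // iter_cancel.
Qed.

(* Otherwise all points of [Q] have the same itinerary through [A]; as the
   orbit of a point of [Q] returns to [Q], this itinerary is periodic, and the
   points having it form the base of a cyclic clopen partition. *)
Lemma spectrally_aperiodic_splits (A Q : set X) :
  spectrally_aperiodic T -> clopen A -> A !=set0 -> ~` A !=set0 ->
  open Q -> Q !=set0 ->
  exists m x y, [/\ Q x, Q y, A (iter m T x) & ~ A (iter m T y)].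
Proof.
move=> apT cA [a Aa] [b Ab] oQ Q0; apply: contrapT => nsplit; apply: apT.
have [cT cT' TK T'K] := homT.
(* [name z] is the itinerary of [z] and [sh] the shift. Every point is a forward iterate of a point
   of [Q], so every itinerary is a shift of [w]. *)
pose name z := fun i => `[< A (iter i T z) >].
pose sh j (w : nat -> bool) := fun i => w (i + j)%N.
have shD i j w : sh i (sh j w) = sh (i + j)%N w.
  by apply/funext => l; rewrite /sh addnA.
have name_iter j z : name (iter j T z) = sh j (name z).
  by apply/funext => i; rewrite /name /sh iterD.
have nameQ x y : Q x -> Q y -> name x = name y.
  move=> Qx Qy; apply/funext => i; apply: asbool_equiv_eq.
  by split=> Ai; apply: contrapT => nAi; apply: nsplit;
    [exists i, x, y|exists i, y, x].
have [q Qq] := Q0; pose w := name q.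
have nameX z : exists j, name z = sh j w.
  have [k [q' [Qq' ->]]] := minimal_backward oQ Q0 z.
  by exists k; rewrite name_iter (nameQ _ _ Qq' Qq).
have : exists p, (0 < p)%N && `[< sh p w = w >].
  have [L /(_ (T q))[k _ Qk]] := minimal_syndetic oQ Q0.
  by exists k.+1; apply/asboolP; rewrite -name_iter iterSr; exact: nameQ.
case/ex_minnP => p /andP[p_gt0 /asboolP shp] p_min.
have shM k : sh (k * p)%N w = w by elim: k => [|k IH];
  [apply/funext => i; rewrite /sh mul0n addn0|rewrite mulSn addnC -shD shp].
have sh_mod j : sh (j %% p)%N w = sh j w.
  by rewrite {2}(divn_eq j p) addnC -shD shM.
(* A shift by [k] is undone on the shifts of [w] by the shift by [k * p - k], the total being a
   multiple of the period. *)
have sh_inj k j : sh k (sh j w) = sh k w -> sh j w = w.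
  move=> /(congr1 (sh (k * p - k)%N)); rewrite !shD.
  have kp : (k <= k * p)%N by rewrite leq_pmulr.
  by rewrite subnK // shM addnC -shD shM.
pose E := [set z | name z = w].
(* All itineraries have period [p], so finitely many conditions determine [E], which makes it
   clopen. *)
have EE : E = [set z | forall i, (i < p)%N -> [set z | A (iter i T z) <-> w i] z].
  apply/seteqP; split=> z /= zE.
    by move=> i _; rewrite -zE; split=> /asboolP.
    apply/funext => i; have [j nz] := nameX z.
  have per l (v : nat -> bool) : sh p v = v -> v l = v (l %% p)%N.
    move=> pv; rewrite {1}(divn_eq l p); elim: (l %/ p)%N => // c IHc.
    by rewrite mulSn -addnA addnC -[RHS]IHc -[in RHS]pv.
  rewrite per ?(per i w) // ?nz ?shD 1?addnC -?shD ?shp // -nz.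
  have := zE (i %% p)%N (ltn_pmod i p_gt0).
  by rewrite /name => iff; apply/asboolP/idP => /iff.
have clE : clopen E.
  rewrite EE; apply: clopen_forall_lt => i.
  have cAi : clopen (iter i T @^-1` A).
    by apply: preimage_clopen => //; exact: continuous_iter.
  case: (w i); first rewrite (_ : [set z | _] = iter i T @^-1` A) //.
    by apply/seteqP; split=> z /=; [move=> ->|split].
  rewrite (_ : [set z | _] = ~` (iter i T @^-1` A)); first exact: clopenC.
  by apply/seteqP; split=> z /=; [move=> -> //|move=> nA; split].
have TE k z : (iter k T @` E) z <-> name z = sh k w.
  split=> [[y Ey <-]|nz]; first by rewrite name_iter Ey.
  have iK : iter k T (iter k T' z) = z by exact: iter_cancel.
  exists (iter k T' z) => //; have [j nj] := nameX (iter k T' z).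
  by rewrite /E /= nj; apply: (sh_inj k); rewrite -nj -name_iter iK.
(* With period 1 all itineraries would agree, yet those of [a] and [b] differ at time 0. Thus [p.-1]
   is at least 1, as the forbidden partition requires. *)
have p_gt1 : (1 < p)%N.
  rewrite ltn_neqAle p_gt0 andbT; apply/eqP => p1; have [j ja] := nameX a.
  have [l lb] := nameX b; apply: Ab.
  have : name b 0%N = name a 0%N by rewrite ja lb -(sh_mod j) -(sh_mod l) -p1 !modn1.
  by move=> nm; apply/asboolP; rewrite -[X in is_true X]/(name b 0%N) nm; exact/asboolP.
exists E, p.-1; split=> //; first by lia.
- apply/trivIsetP => i j ip jp ij; apply/seteqP; split=> // z.
  move=> [/TE nzi /TE]; rewrite nzi {nzi}.
  wlog lt_ij : i j ip jp ij / (i < j)%N.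
    move=> wl; have [ltij|ltji|eqij] := ltngtP i j; first exact: wl.
      by move/esym; apply: wl => //; rewrite eq_sym.
    by rewrite eqij eqxx in ij.
  move=> /(congr1 (sh (p - j)%N)); rewrite !shD subnK; last by move: jp => /=; lia.
  rewrite shp => shw; have : (p <= p - j + i)%N.
    by apply: p_min; apply/andP; split; [move: jp => /=; lia|exact/asboolP].
  by move: jp => /=; lia.
- apply/seteqP; split=> // z _; have [j nj] := nameX z.
  exists (j %% p)%N; last by apply/TE; rewrite sh_mod.
  by rewrite /= -ltnS prednK // ltn_pmod.
Qed.
End MinimalHomeomorphism.

(** * Conjugacy invariance of the dynamical conditions *)

Lemma iter_conj (X : Type) (h h' T : X -> X) (n : nat) (x : X) :
  cancel h h' -> cancel h' h -> iter n (h \o T \o h') x = h (iter n T (h' x)).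
Proof. by move=> hK h'K; elim: n => [|n IH] //=; rewrite ?h'K // IH hK. Qed.

Section Conjugation.
Variables (X : ptopologicalType) (h h' T : X -> X).
Hypothesis homh : homeo_with_inverse h h'.

Lemma minimal_conj : minimal T -> minimal (h \o T \o h').
Proof.
have [ch ch' hK h'K] := homh => minT C cC TC.
have [] := minT (h @^-1` C).
- by apply: closed_comp.
- apply/seteqP; split=> [_ [x Cx <-]|x Cx].
    by rewrite /preimage /= -TC; exists (h x); rewrite //= hK.
  have : C (h x) by []; rewrite -TC => -[y Cy] /(can_inj hK) <-.
  by exists (h' y) => //; rewrite TC /preimage /= h'K.
- move=> C0; left; apply/seteqP; split=> // x Cx.
  by have : (h @^-1` C) (h' x); [rewrite /preimage /= h'K|rewrite C0].
- move=> CT; right; apply/seteqP; split=> // x _.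
  by have : (h @^-1` C) (h' x); [rewrite CT|rewrite /preimage /= h'K].
Qed.

Lemma spectrally_aperiodic_conj :
  spectrally_aperiodic T -> spectrally_aperiodic (h \o T \o h').
Proof.
have [ch ch' hK h'K] := homh => apT [A [n [cA n_gt0 tA covA]]]; apply: apT.
have iterE k : iter k T @` (h @^-1` A) = h @^-1` (iter k (h \o T \o h') @` A).
  apply/seteqP; split=> [_ [x Ax <-]|x [y Ay yx]].
    by exists (h x) => //; rewrite iter_conj // hK.
  exists (h' y); first by rewrite /preimage /= h'K.
  by apply: (can_inj hK); rewrite -yx iter_conj.
exists (h @^-1` A), n; split=> //; first exact: preimage_clopen.
- apply/trivIsetP => i j ni nj ij; rewrite !iterE -preimage_setI.
  by move/trivIsetP: tA => -> //; rewrite preimage_set0.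
- under eq_bigcupr do rewrite iterE.
  by rewrite -preimage_bigcup covA preimage_setT.
Qed.
End Conjugation.

(** * Borel probability measures and their images *)

Lemma continuous_measurable_borel (X : ptopologicalType) (f : X -> X) :
  continuous f -> measurable_fun setT (f : borel X -> borel X).
Proof.
move=> cf.
apply: (@measurability _ _ (borel X) (borel X) setT f (@open X)) => // _ [U oU <-].
by rewrite setTI; apply: sub_sigma_algebra; apply: open_comp.
Qed.

Lemma measurable_preimage_borel (X : ptopologicalType) (f : X -> X)
    (A : set (borel X)) :
  continuous f -> measurable A -> measurable (f @^-1` A : set (borel X)).
Proof.
move=> /continuous_measurable_borel mf mA.
by rewrite -[X in measurable X]setTI; exact: mf.
Qed.

Section InvariantMeasures.
Variables (R : realType) (X : ptopologicalType).
Implicit Types (T h : X -> X) (mu : probability (borel X) R).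

Lemma probability_image h mu : continuous h -> exists nu : probability (borel X) R,
  forall A : set (borel X), nu A = mu (h @^-1` A).
Proof.
move=> ch; have mh := continuous_measurable_borel ch.
pose hm := mfun_Sub (mem_set mh : (h : borel X -> borel X) \in mfun).
by exists (distribution mu hm).
Qed.

(** Images under [h] and [h'] match the invariant measures of [T] with those of its conjugate, so
    existence and uniqueness carry over. *)
Lemma strictly_ergodic_conj h h' T : homeo_with_inverse h h' -> continuous T ->
  strictly_ergodic R T -> strictly_ergodic R (h \o T \o h').
Proof.
move=> homh cT [minT [mu [muT uniq]]]; split; first exact: minimal_conj.
have [ch ch' hK h'K] := homh.
have [nu nuE] := probability_image mu ch; exists nu; split=> [A mA|la laT A mA].
  rewrite !nuE -(muT (h @^-1` A)); last exact: measurable_preimage_borel.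
  have -> : h @^-1` ((h \o T \o h') @^-1` A) = T @^-1` (h @^-1` A) => //.
  by apply/seteqP; split=> x; rewrite /preimage /= hK.
have [la' la'E] := probability_image la ch'.
have -> : la A = la' (h @^-1` A).
  rewrite la'E; have -> // : h' @^-1` (h @^-1` A) = A.
  by apply/seteqP; split=> x; rewrite /preimage /= h'K.
rewrite nuE; apply: uniq; last exact: measurable_preimage_borel.
move=> B mB; rewrite !la'E -[RHS]laT; last exact: measurable_preimage_borel.
have -> // : h' @^-1` (T @^-1` B) = (h \o T \o h') @^-1` (h' @^-1` B).
by apply/seteqP; split=> x; rewrite /preimage /= hK.
Qed.

Lemma invariant_prob_comp T T' mu : continuous T' ->
  invariant_prob T mu -> invariant_prob T' mu -> invariant_prob (T' \o T) mu.
Proof.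
move=> cT' muT muT' A mA; rewrite comp_preimage muT ?muT' //.
exact: measurable_preimage_borel.
Qed.

Lemma invariant_prob_iter T mu n : continuous T ->
  invariant_prob T mu -> invariant_prob (iter n T) mu.
Proof.
move=> cT muT; elim: n => [|n IH] A mA //.
exact: (invariant_prob_comp cT IH muT).
Qed.

End InvariantMeasures.

(** * The involution exchanging a clopen set with a translate *)

Lemma continuous_if_clopen (X Y : topologicalType) (D : set X) (f g : X -> Y) :
  clopen D -> continuous f -> continuous g ->
  continuous (fun x => if `[< D x >] then f x else g x).
Proof.
move=> [oD cD] cf cg x U; case: ifPn => [/asboolP Dx|/asboolP nDx] nU.
  have : nbhs x D by exact: open_nbhs_nbhs.
  move: (cf x U nU); rewrite /= !nbhs_simpl /=.
  by apply: filterS2 => y fy /asboolP Dy; rewrite /preimage /= Dy.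
have : nbhs x (~` D) by apply: open_nbhs_nbhs; split=> //; rewrite openC.
move: (cg x U nU); rewrite /= !nbhs_simpl /=.
by apply: filterS2 => y gy /asboolPn/negbTE nDy; rewrite /preimage /= nDy.
Qed.

(** With [T'] inverse to [T], the second test says that [x] lies in the image of [D]. This is an
    involution once [D] and its image are disjoint. *)
Definition swap (X : Type) (T T' : X -> X) (D : set X) (x : X) : X :=
  if `[< D x >] then T x else if `[< D (T' x) >] then T' x else x.

Section Swap.
Variables (X : ptopologicalType) (T T' : X -> X) (D : set X).
Hypotheses (homT : homeo_with_inverse T T') (clD : clopen D)
  (disjD : forall x, D x -> ~ D (T x)).

Let TK : cancel T T'. Proof. by case: homT. Qed.
Let T'K : cancel T' T. Proof. by case: homT. Qed.

Lemma swap_in x : D x -> swap T T' D x = T x.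
Proof. by move=> /asboolP Dx; rewrite /swap Dx. Qed.

Lemma swap_im x : D (T' x) -> swap T T' D x = T' x.
Proof.
move=> Dx; have := disjD Dx; rewrite T'K => nDx.
by rewrite /swap (introF (asboolP _) nDx) (introT (asboolP _) Dx).
Qed.

Lemma swap_out x : ~ D x -> ~ D (T' x) -> swap T T' D x = x.
Proof. by move=> Dx DTx; rewrite /swap !(introF (asboolP _) _). Qed.

Lemma swapP (P : X -> X -> Prop) :
  (forall x, D x -> P x (T x)) -> (forall x, D (T' x) -> P x (T' x)) ->
  (forall x, ~ D x -> ~ D (T' x) -> P x x) -> forall x, P x (swap T T' D x).
Proof.
move=> Pin Pim Pout x; have [Dx|nDx] := pselect (D x).
  by rewrite swap_in //; exact: Pin.
have [DTx|nDTx] := pselect (D (T' x)); first by rewrite swap_im //; exact: Pim.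
by rewrite swap_out //; exact: Pout.
Qed.

Lemma swapK : involutive (swap T T' D).
Proof.
apply: (@swapP (fun x y => swap T T' D y = x)) => x Dx.
- by rewrite swap_im ?TK.
- by rewrite swap_in ?T'K.
- exact: swap_out.
Qed.

Lemma swap_continuous : continuous (swap T T' D).
Proof.
have [cT cT' _ _] := homT.
apply: continuous_if_clopen => //.
apply: (@continuous_if_clopen _ _ (T' @^-1` D)) => //; first exact: preimage_clopen.
by move=> x; exact: cvg_id.
Qed.

Lemma swap_homeo : homeo_with_inverse (swap T T' D) (swap T T' D).
Proof. by split; try exact: swapK; exact: swap_continuous. Qed.

(** The preimage of [A] is cut along [D], its image [D'] and the rest. [T] and [T'] carry the first
    two pieces to the parts of [A] in [D'] and in [D] without changing their measure. *)
Lemma swap_invariant (R : realType) (mu : probability (borel X) R) :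
  invariant_prob T mu -> invariant_prob T' mu -> invariant_prob (swap T T' D) mu.
Proof.
move=> muT muT' A mA; have [cT cT' _ _] := homT.
have mD : measurable (D : set (borel X)) by apply: sub_sigma_algebra; case: clD.
have mpre (f : X -> X) (B : set (borel X)) : continuous f -> measurable B ->
    measurable (f @^-1` B : set (borel X)) by exact: measurable_preimage_borel.
pose D' : set (borel X) := T' @^-1` D.
have mD' : measurable D' by exact: mpre.
have mADD' : measurable (A `\` (D `|` D') : set (borel X)).
  by apply: measurableD => //; exact: measurableU.
have DD' x : D x -> D' x -> False by move=> Dx /disjD; rewrite T'K.
have split3 (B C : set (borel X)) : measurable B -> measurable C ->
    B `<=` D -> C `<=` D' ->
    mu (B `|` C `|` (A `\` (D `|` D'))) = (mu B + mu C + mu (A `\` (D `|` D')))%E.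
  move=> mB mC BD CD; rewrite measureU //; last 2 first.
  - exact: measurableU.
  - by apply/seteqP; split=> // x [[/BD|/CD] Dx [_]]; apply; [left|right].
  congr (_ + _)%E; rewrite measureU //.
  by apply/seteqP; split=> // x [/BD Dx /CD]; exact: DD'.
have -> : swap T T' D @^-1` A =
    (D `&` T @^-1` A) `|` (T' @^-1` (D `&` A)) `|` (A `\` (D `|` D')).
  apply/seteqP; split=> x; rewrite /preimage /=.
    apply: (@swapP (fun x y => A y -> _)) => {}x Dx; first by left; left.
      by left; right.
    by move=> nDx Ax; right; split=> // -[].
  case=> [[[Dx ATx]|[DTx ATx]]|[Ax nDx]].
  - by rewrite swap_in.
  - by rewrite swap_im.
  - by rewrite swap_out // => Dx; apply: nDx; [left|right].
rewrite split3 //; last 3 first.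
- by apply: measurableI => //; exact: mpre.
- by apply: mpre => //; exact: measurableI.
- by move=> x [].
rewrite muT'; last exact: measurableI.
rewrite -(muT' (D `&` T @^-1` A)); last by apply: measurableI => //; exact: mpre.
rewrite [X in (X + _)%E]addeC.
have -> : T' @^-1` (D `&` T @^-1` A) = D' `&` A.
  by apply/seteqP; split=> x; rewrite /preimage /= T'K.
rewrite -split3; last 4 first.
- exact: measurableI.
- exact: measurableI.
- by move=> x [].
- by move=> x [].
congr (mu _); apply/seteqP; split=> x; first by case=> [[[]|[]]|[]].
move=> Ax; have [Dx|nDx] := pselect (D x); first by left; left.
by have [D'x|nD'x] := pselect (D' x); [left; right|right; split=> // -[]].
Qed.

End Swap.

(** * Words in the free group and their action *)

Section Words.
Variable d : nat.
Implicit Types (u v w : seq (letter d)) (c : letter d).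

(** Multiplying an arbitrary word into the empty one performs its free reduction. *)
Definition fg_of_word w : free_group d := FreeGroup (@reduced_wmul d w [::] isT).

Lemma fg_of_wordK (s : free_group d) : fg_of_word s = s.
Proof. by apply: val_inj; rewrite /= wmul0 ?fg_reduced. Qed.

Lemma fg_of_word_cat u v : fg_of_word (u ++ v) = (fg_of_word u * fg_of_word v)%g.
Proof.
by apply: val_inj; rewrite /= -wmulA ?reduced_wmul //= /wmul foldr_cat.
Qed.

Lemma fg_of_word_eq1 w : reduced w -> fg_of_word w = 1%g -> w = [::].
Proof. by move=> rw /(congr1 (@fg_word d)); rewrite /= wmul0. Qed.

Lemma fgenE i : fgen i = fg_of_word [:: (i, false)].
Proof. exact: val_inj. Qed.

Variables (X : Type) (f : letter d -> X -> X).
Hypothesis fK : forall c, cancel (f c) (f (linv c)).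

Lemma foldr_push c w x : foldr f x (push c w) = f c (foldr f x w).
Proof.
case: w => [|b w] //=; case: ifPn => [/eqP ->|//].
by rewrite -{1}(linvK c) fK.
Qed.

Lemma foldr_wmul u v x : foldr f x (wmul u v) = foldr f (foldr f x v) u.
Proof. by elim: u => //= c u IH; rewrite foldr_push IH. Qed.

End Words.

Section ActionLetters.
Variables (d : nat) (X : uniformType) (alpha : elementwise d X).
Hypothesis act : Act d X alpha.

Definition act_letter (c : letter d) (x : X) : X := alpha (fg_of_word [:: c]) x.

Lemma act_fg_of_word w x : alpha (fg_of_word w) x = foldr act_letter x w.
Proof.
have [_ act1 actM] := act; elim: w x => [|c w IH] x.
  by rewrite -[RHS]act1; congr (alpha _ _); exact: val_inj.
by rewrite -cat1s fg_of_word_cat actM IH.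
Qed.

Lemma actE s x : alpha s x = foldr act_letter x s.
Proof. by rewrite -act_fg_of_word fg_of_wordK. Qed.

Lemma act_letterK c : cancel (act_letter c) (act_letter (linv c)).
Proof.
have [_ act1 actM] := act => x; rewrite /act_letter -actM -[RHS]act1.
congr (alpha _ _); rewrite -fg_of_word_cat; apply: val_inj.
by rewrite /= linvK eqxx.
Qed.

Lemma act_letter_homeo c :
  homeo_with_inverse (act_letter c) (act_letter (linv c)).
Proof.
have [actH _ _] := act.
have cont b : continuous (act_letter b).
  by have [? []] := actH (fg_of_word [:: b]).
by split=> //; [exact: act_letterK|move=> x; rewrite -{1}(linvK c) act_letterK].
Qed.

Lemma free_point_inj x u v : (forall s, alpha s x = x -> s = 1%g) ->
  foldr act_letter x u = foldr act_letter x v -> fg_of_word u = fg_of_word v.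
Proof.
have [_ act1 actM] := act => free uv.
have : ((fg_of_word v)^-1 * fg_of_word u)%g = 1%g.
  apply: free; rewrite actM act_fg_of_word uv -act_fg_of_word -actM.
  by rewrite mulVg act1.
by move=> vu; rewrite -[LHS](mulVKg (fg_of_word v)) vu mulg1.
Qed.

End ActionLetters.

(** * Conjugating one generator by an involution *)

Section Perturbation.
Variables (d : nat) (X : puniformType) (alpha : elementwise d X).
Variables (h : X -> X) (i0 : 'I_d).
Hypotheses (act : Act d X alpha) (hK : involutive h).

Local Notation f := (act_letter alpha).

(** Both signs of the generator [i0] are conjugated, so inverse letters still act by inverse
    maps. *)
Definition pert_letter (c : letter d) (x : X) : X :=
  if c.1 == i0 then h (f c (h x)) else f c x.

Definition perturbation : elementwise d X :=
  fun s (x : X) => foldr pert_letter x (fg_word s).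

Local Notation g := pert_letter.
Local Notation beta := perturbation.

Lemma pert_letterK c : cancel (g c) (g (linv c)).
Proof.
move=> x; rewrite /pert_letter /=; case: eqP => _; last exact: act_letterK.
by rewrite hK (act_letterK act c) hK.
Qed.

Lemma pert_fg_of_word w x : beta (fg_of_word w) x = foldr g x w.
Proof. by rewrite /perturbation /= foldr_wmul //; exact: pert_letterK. Qed.

Lemma pert_gen x : beta (fgen i0) x = h (alpha (fgen i0) (h x)).
Proof. by rewrite fgenE pert_fg_of_word /= /pert_letter eqxx. Qed.

Lemma pert_gen_neq i x : i != i0 -> beta (fgen i) x = alpha (fgen i) x.
Proof. by move=> /negPf ii0; rewrite !fgenE pert_fg_of_word /= /pert_letter ii0. Qed.

Lemma pert_act : continuous h -> Act d X beta.
Proof.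
move=> ch.
have actM s t x : beta (s * t)%g x = beta s (beta t x).
  by rewrite /perturbation /= foldr_wmul //; exact: pert_letterK.
have cont s : continuous (beta s : X -> X).
  rewrite /perturbation; elim: (fg_word s) => [|c w IH] x /=; first exact: cvg_id.
  have cf : continuous (f c) by have [] := act_letter_homeo act c.
  apply: (@continuous_comp _ _ _ (fun x => foldr g x w) (g c)); first exact: IH.
  rewrite /pert_letter; case: (c.1 == i0); last exact: cf.
  apply: (@continuous_comp _ _ _ (f c \o h) h); last exact: ch.
  by apply: continuous_comp; [exact: ch|exact: cf].
have actV s t x : (s * t)%g = 1%g -> beta s (beta t x) = x.
  by move=> st; rewrite -actM st.
split=> // s; exists (beta s^-1%g : X -> X); split.
- exact: cont.
- exact: cont.
- by move=> x; apply: actV; rewrite mulVg.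
- by move=> x; apply: actV; rewrite mulgV.
Qed.

Let off_head (v : seq (letter d)) : bool :=
  if v is c :: _ then c.1 != i0 else true.

Lemma reduced_cat_letters (u v : seq (letter d)) :
  all (fun c => c.1 == i0) u -> reduced u -> reduced v ->
  off_head v -> reduced (u ++ v).
Proof.
case: u => [|a u] //= au ru rv hv; rewrite cat_path ru /=.
have {au ru} : (last a u).1 == i0.
  by move: au => /andP[a0 /allP u0]; case/lastP: u u0 {ru} => // u b u0;
    rewrite last_rcons; apply: u0; rewrite mem_rcons mem_head.
case: v rv hv => //= b v rv bi0 /eqP li0; rewrite rv andbT /nocancel.
by apply: contraNneq bi0 => ->; rewrite /= li0.
Qed.

Lemma all_wmul (P : pred 'I_d) (u v : seq (letter d)) :
  all (fun c => P c.1) u -> all (fun c => P c.1) v ->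
  all (fun c => P c.1) (wmul u v).
Proof.
elim: u => //= c u IH /andP[Pc Pu] Pv; move: (IH Pu Pv).
case: (wmul u v) => [|b w] /=; first by rewrite Pc.
by case: ifP => _ /= => [/andP[]|->]; rewrite ?Pc.
Qed.

Section FreePoints.
Variable x : X.
Hypothesis free : forall s, alpha s x = x -> s = 1%g.
Hypothesis h_orbit : forall y, exists2 q : seq (letter d),
  all (fun c => c.1 == i0) q & h y = foldr f y q.

(* If the reduced form of the middle word were empty, the word [p] would fix a
   point of the orbit of [x]. *)
Lemma conj_syllable (p v : seq (letter d)) :
  p != [::] -> reduced p -> all (fun c => c.1 == i0) p ->
  exists u, [/\ u != [::], reduced u, all (fun c => c.1 == i0) u &
    h (foldr f (h (foldr f x v)) p) = foldr f x (u ++ v)].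
Proof.
move=> p0 rp ap; set y := foldr f x v.
have [q2 aq2 hq2] := h_orbit y.
have [q1 aq1 hq1] := h_orbit (foldr f (h y) p).
pose u := wmul (q1 ++ p ++ q2) [::].
have uE : h (foldr f (h y) p) = foldr f x (u ++ v).
  rewrite foldr_cat foldr_wmul /=; last exact: (act_letterK act).
  by rewrite hq1 hq2 !foldr_cat.
exists u; split=> //; last 2 first.
- exact: reduced_wmul.
- by apply: (@all_wmul (pred1 i0)) => //; rewrite !all_cat aq1 aq2 [all _ p]ap.
apply: contra_neq p0 => u0; apply: fg_of_word_eq1 => //.
move: uE; rewrite u0 /= -/y => /(congr1 h); rewrite hK hq2 => pq.
have : fg_of_word (p ++ q2 ++ v) = fg_of_word (q2 ++ v).
  by apply: (free_point_inj act free); rewrite !foldr_cat.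
by rewrite fg_of_word_cat -[RHS]mul1g => /mulIg.
Qed.

(** Here [p] is the leading [i0]-syllable, kept open because the inner pairs of [h] cancel while it
    grows, and [v] is the word in the original action that represents the rest. Equality of the
    heads of [v] and [w1] tells which letters can be prepended without cancellation. *)
Lemma pert_word (w : seq (letter d)) : reduced w ->
  exists p w1 v, [/\ w = p ++ w1, all (fun c => c.1 == i0) p, reduced v,
    ohead v = ohead w1 /\ off_head v &
    foldr g x w = h (foldr f (h (foldr f x v)) p)].
Proof.
elim: w => [|c w IH] rw.
  by exists [::], [::], [::]; split=> //=; rewrite hK.
have [p [w1 [v [wE ap rv [hv nv] gE]]]] := IH (path_sorted rw).
have [ci0|ci0] := eqVneq c.1 i0.
  exists (c :: p), w1, v; split=> //=; first by rewrite wE.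
    by rewrite ci0 eqxx.
  by rewrite gE /pert_letter ci0 eqxx hK.
have [p0|p0] := eqVneq p [::].
  rewrite p0 /= hK in wE gE; exists [::], (c :: w), (c :: v); split=> //; last first.
    by rewrite /= hK gE /pert_letter (negPf ci0).
  - move: rw hv; rewrite wE; case: (w1) => [|b w'] /=; case: (v) rv => [|e v'] //=.
    by move=> re /andP[cb _] [eb]; rewrite {1}eb cb.
have rp : reduced p.
  by move: rw; rewrite wE /reduced /= => /path_sorted /cat_sorted2[].
(* The syllable closes: it becomes a nonempty word [u] in the letters of [i0], which cancels neither
   with [c] nor with the head of [v]. *)
have [u [u0 ru au uE]] := conj_syllable v p0 rp ap.
exists [::], (c :: w), (c :: u ++ v); split=> //=.
- have := reduced_cat_letters au ru rv nv.
  case: u u0 au {ru uE} => // a u _ /= /andP[/eqP ai0 _] ->; rewrite andbT /nocancel.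
  by apply: contraNneq ci0 => /(congr1 fst) /= <-; rewrite ai0.
- by rewrite hK gE uE /pert_letter (negPf ci0).
Qed.

(** If the leading syllable is empty, [v] fixes [x], so [v] is empty and so is [w1], having the same
    head. Otherwise the nonempty reduced word [u ++ v] would fix [x]. *)
Lemma pert_free_point s : beta s x = x -> s = 1%g.
Proof.
have [p [w1 [v [wE ap rv [hv nv] gE]]]] := pert_word (fg_reduced s).
rewrite /perturbation gE => fixx.
apply: val_inj; rewrite /= [fg_word s]wE.
have [p0|p0] := eqVneq p [::].
  rewrite p0 /= hK in fixx *.
  have v0 : v = [::] by apply: fg_of_word_eq1 => //; apply: free; rewrite act_fg_of_word.
  by move: hv; rewrite v0; case: (w1).
have rp : reduced p.
  by move: (fg_reduced s); rewrite wE /reduced => /cat_sorted2[].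
have [u [u0 ru au uE]] := conj_syllable v p0 rp ap.
have : u ++ v = [::].
  apply: fg_of_word_eq1; first exact: reduced_cat_letters.
  by apply: free; rewrite act_fg_of_word // -uE.
by case: u u0 {uE ru au}.
Qed.

End FreePoints.

End Perturbation.

(** Induction on words: a conjugated letter adds two displacements by [h], and uniform continuity of
    the letter controls the inner one. [W] is chosen before [h]. *)
Lemma pert_close (d : nat) (X : puniformType) (alpha : elementwise d X)
    (i0 : 'I_d) (E : seq (free_group d)) (V : set (X * X)) :
  compact [set: X] -> Act d X alpha -> entourage V ->
  exists2 W : set (X * X), entourage W &
    forall h : X -> X, (forall x, W (x, h x)) ->
      forall s, s \in E -> forall x, V (alpha s x, perturbation alpha h i0 s x).
Proof.
move=> cX act entV; set f := act_letter alpha.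
have cf c : continuous (f c) by have [] := act_letter_homeo act c.
have wordP w : forall V, entourage V -> exists2 W : set (X * X), entourage W &
    forall h : X -> X, (forall x, W (x, h x)) ->
      forall x, V (foldr f x w, foldr (pert_letter alpha h i0) x w).
  elim: w => [|c w IH] {}V {}entV.
    by exists setT; [exact: filterT|move=> h _ x; exact: entourage_refl].
  pose V1 := split_ent V; have entV1 : entourage V1 by exact: entourage_split_ent.
  pose V2 := [set yz : X * X | V1 (f c yz.1, f c yz.2)].
  have entV2 : entourage V2 by exact: compact_unif_continuous.
  have [W entW WP] := IH _ (entourage_split_ent entV2).
  exists (W `&` (V1 `&` split_ent V2)).
    by apply: filterI => //; apply: filterI => //; exact: entourage_split_ent.
  move=> h Wh x; have wh := WP h (fun x => proj1 (Wh x)) x.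
  rewrite /= /pert_letter; case: (c.1 == i0); last first.
    by apply: (split_ent_subset entV); exact: (split_ent_subset entV2 wh).
  apply: (entourage_split (f c (h (foldr (pert_letter alpha h i0) x w)))) => //.
    exact: (entourage_split _ entV2 wh (proj2 (proj2 (Wh _)))).
  exact: (proj1 (proj2 (Wh _))).
elim: E => [|s E [W entW WP]]; first by exists setT; [exact: filterT|].
have [W' entW' WP'] := wordP s V entV.
exists (W `&` W'); first exact: filterI.
move=> h Wh t; rewrite in_cons => /predU1P[->|tE] x.
  by rewrite actE //; apply: WP' => y; have [] := Wh y.
by apply: WP => // y; have [] := Wh y.
Qed.

(** The condition that [h] moves points along [i0]-orbits serves topological freeness; the one on
    measures provides a measure invariant under the new action. *)
Lemma pert_Astar (R : realType) (d : nat) (X : puniformType)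
    (alpha : elementwise d X) (h : X -> X) (i0 : 'I_d) :
  Astar R d X alpha -> homeo_with_inverse h h ->
  (forall x, exists2 q : seq (letter d),
     all (fun c => c.1 == i0) q & h x = foldr (act_letter alpha) x q) ->
  (forall mu : probability (borel X) R,
     (forall s, invariant_prob (alpha s : X -> X) mu) -> invariant_prob h mu) ->
  Astar R d X (perturbation alpha h i0).
Proof.
move=> [act free [mu mualpha] gens] homh h_orbit h_inv.
have [ch _ hK _] := homh.
have cf c : continuous (act_letter alpha c) by have [] := act_letter_homeo act c.
split; first exact: pert_act.
- move=> O O0 oO; have [x [Ox freex]] := free O O0 oO; exists x; split=> //.
  by move=> s; exact: (pert_free_point act hK freex h_orbit).
- exists mu => s; have hmu := h_inv mu mualpha.
  have cg c : continuous (pert_letter alpha h i0 c).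
    rewrite /pert_letter; case: (c.1 == i0) => x; last exact: cf.
    apply: (@continuous_comp _ _ _ (act_letter alpha c \o h) h); last exact: ch.
    by apply: continuous_comp; [exact: ch|exact: cf].
  rewrite /perturbation; elim: (fg_word s) => [|c w IH] //=.
  apply: (@invariant_prob_comp _ _ (fun x => foldr _ x w)) => //.
  rewrite /pert_letter; case: (c.1 == i0); last exact: mualpha.
  apply: (@invariant_prob_comp _ _ (act_letter alpha c \o h) h) => //.
  by apply: (@invariant_prob_comp _ _ h (act_letter alpha c)) => //; exact: mualpha.
- move=> i; have [se sa] := gens i; have [ii0|ii0] := eqVneq i i0; last first.
    have -> : perturbation alpha h i0 (fgen i) = alpha (fgen i); last by [].
    by apply/funext => x; exact: pert_gen_neq.
  rewrite ii0 in se sa *.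
  have -> : perturbation alpha h i0 (fgen i0) = h \o (alpha (fgen i0) : X -> X) \o h.
    by apply/funext => x; exact: pert_gen.
  split; last exact: spectrally_aperiodic_conj.
  by apply: strictly_ergodic_conj => //; rewrite fgenE; exact: cf.
Qed.

(** * Visit counts as conjugacy invariants *)

Section Visits.
Variables (X : Type) (T : X -> X).

Definition visits (C : set X) (N : nat) (x : X) : nat :=
  count (fun k => `[< C (iter k T x) >]) (iota 0 N).

(** Every window of length [L.+1] meets [D], so [C'] is visited strictly more often than [C] from
    each starting point. The least bound for [C'], minus one, is the required [K]; the point [x0]
    shows that this least bound is positive. *)
Lemma visits_gap (C C' D : set X) (L : nat) (x0 : X) :
  (forall x, C' x <-> C x \/ D x) -> (forall x, C x -> ~ D x) ->
  (forall x, exists2 k, (k <= L)%N & D (iter k T x)) ->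
  exists K, (forall x, visits C L.+1 x <= K)%N /\
            ~ (forall x, visits C' L.+1 x <= K)%N.
Proof.
move=> C'E CD DL.
have gap x : (visits C L.+1 x < visits C' L.+1 x)%N.
  have -> : visits C' L.+1 x = (visits C L.+1 x + visits D L.+1 x)%N.
    rewrite /visits; elim: (iota 0 L.+1) => //= k s ->.
    rewrite addnACA; congr (_ + _)%N; move: (iter k T x) => y.
    have -> : `[< C' y >] = `[< C y >] || `[< D y >].
      by rewrite -asbool_or; exact: asbool_equiv_eq.
    have : ~~ (`[< C y >] && `[< D y >]).
      by apply/negP => /andP[/asboolP Cy /asboolP]; exact: CD.
    by case: asbool; case: asbool.
  rewrite -[X in (X < _)%N]addn0 ltn_add2l /visits -has_count.
  have [k kL Dk] := DL x; apply/hasP; exists k; last exact/asboolP.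
  by rewrite mem_iota.
have bnd : exists K, `[< forall x, (visits C' L.+1 x <= K)%N >].
  exists L.+1; apply/asboolP => x; rewrite /visits -[X in (_ <= X)%N](size_iota 0).
  exact: count_size.
case/ex_minnP: bnd => -[|K] /asboolP bK minK.
  by have := leq_trans (gap x0) (bK x0).
exists K; split=> [x|/asboolP/minK]; last by rewrite ltnn.
by rewrite -ltnS; exact: leq_trans (gap x) (bK x).
Qed.
End Visits.

Section Patterns.
Variables (d : nat) (i0 i1 : 'I_d).

Definition double_entry (X : uniformType) (alpha : elementwise d X) (A : set X)
    (m n : nat) : set X :=
  [set x | A (iter m (alpha (fgen i1)) x) /\ A (iter n (alpha (fgen i0)) x)].

(** The maximal number of visits is encoded by its upper bounds [K]. *)
Definition visit_bound (X : uniformType) (alpha : elementwise d X) (A : set X)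
    (m n N K : nat) : Prop :=
  forall x, (visits (alpha (fgen i1)) (double_entry alpha A m n) N x <= K)%N.

Lemma visit_bound_conj (X : uniformType) (alpha beta : elementwise d X)
    (g h : X -> X) (A : set X) (m n N K : nat) :
  homeo_with_inverse g h ->
  (forall s x, beta s x = g (alpha s (h x))) ->
  visit_bound beta (h @^-1` A) m n N K <-> visit_bound alpha A m n N K.
Proof.
move=> [_ _ gK hK] betaE.
have iterE s k x : h (iter k (beta s) x) = iter k (alpha s) (h x).
  by elim: k => //= k IH; rewrite betaE gK IH.
have visitsE x : visits (beta (fgen i1)) (double_entry beta (h @^-1` A) m n) N x =
    visits (alpha (fgen i1)) (double_entry alpha A m n) N (h x).
  apply: eq_count => k; rewrite /double_entry /preimage /=.
  by rewrite !iterE.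
split=> bnd x; last by rewrite visitsE.
by have := bnd (g x); rewrite visitsE gK.
Qed.

Lemma iter_act (X : uniformType) (alpha : elementwise d X) (s : free_group d)
    (k : nat) (x : X) :
  Act d X alpha -> iter k (alpha s) x = alpha (s ^+ k)%g x.
Proof.
move=> [_ act1 actM]; elim: k => [|k IH] /=; first by rewrite act1.
by rewrite IH -actM expgS.
Qed.

(** The counts only depend on whether the images of a point under the finitely many elements [wm k]
    and [wn k], for [k] below [N], lie in the clopen set [A]. *)
Lemma visit_bound_near (X : puniformType) (alpha : elementwise d X) (A : set X)
    (m n N K : nat) :
  compact [set: X] -> Act d X alpha -> clopen A ->
  nbhs alpha [set beta | Act d X beta ->
    (visit_bound alpha A m n N K <-> visit_bound beta A m n N K)].
Proof.
move=> cX act cA; apply/elementwise_nbhsP.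
pose wm k : free_group d := (fgen i1 ^+ m * fgen i1 ^+ k)%g.
pose wn k : free_group d := (fgen i0 ^+ n * fgen i1 ^+ k)%g.
exists (map wm (iota 0 N) ++ map wn (iota 0 N)), [set yz | A yz.1 <-> A yz.2].
split; first exact: clopen_entourage.
move=> beta near actb.
have visitsE x : visits (alpha (fgen i1)) (double_entry alpha A m n) N x =
    visits (beta (fgen i1)) (double_entry beta A m n) N x.
  apply: eq_in_count => k kN; apply: asbool_equiv_eq.
  rewrite /double_entry /= !iter_act //.
  have [_ _ actM] := act; have [_ _ actMb] := actb.
  have /= := near (wm k) _ x; rewrite mem_cat map_f // => /(_ isT).
  have /= := near (wn k) _ x; rewrite mem_cat [in X in _ || X]map_f // orbT => /(_ isT).
  rewrite !actM !actMb => en em; split=> -[??]; split.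
  - exact/em.
  - exact/en.
  - exact/em.
  - exact/en.
by split=> bnd x; move: (bnd x); rewrite visitsE.
Qed.

End Patterns.

Lemma clopen_small (X : puniformType) (W : set (X * X)) (A : set X) (a : X) :
  compact [set: X] -> hausdorff_space X -> zero_dimensional X ->
  entourage W -> clopen A -> A a ->
  exists Q : set X, [/\ clopen Q, Q a, Q `<=` A &
    forall x y, Q x -> Q y -> W (x, y)].
Proof.
move=> cX hX zX entW [oA cA] Aa; pose V := split_ent W.
have entV : entourage V by exact: entourage_split_ent.
have nA : nbhs a (A `&` xsection (V `&` V^-1)%relation a).
  apply: filterI; first exact: open_nbhs_nbhs.
  by apply: nbhs_entourage; exact: entourage_invI.
have [Q [Qa cQ] QA] := zero_dimensional_cvg hX zX cX nA.
exists Q; split=> // [x /QA[]//|x y /QA[_ /xsectionP[_ ax]] /QA[_ /xsectionP[ay _]]].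
exact: (entourage_split _ entW ax ay).
Qed.

(** * A small perturbation that changes a visit count *)

Section Perturb.
Variables (R : realType) (d : nat) (X : puniformType).
Variables (alpha : elementwise d X) (i0 i1 : 'I_d).
Hypotheses (cX : compact [set: X]) (hX : hausdorff_space X)
  (zX : zero_dimensional X) (i01 : i1 != i0) (Aalpha : Astar R d X alpha).

Local Notation S := (act_letter alpha (i0, false)).
Local Notation S' := (act_letter alpha (i0, true)).
Local Notation T := (act_letter alpha (i1, false)).

Let act : Act d X alpha. Proof. by case: Aalpha. Qed.

Let homSk k : homeo_with_inverse (iter k S) (iter k S').
Proof.
have [cS cS' SK S'K] := act_letter_homeo act (i0, false).
split; [exact: continuous_iter|exact: continuous_iter| |]; exact: iter_cancel.
Qed.

Let genE i : alpha (fgen i) = act_letter alpha (i, false).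
Proof. by rewrite fgenE. Qed.

Lemma swap_orbit k D y : exists2 q : seq (letter d),
  all (fun c => c.1 == i0) q &
  swap (iter k S) (iter k S') D y = foldr (act_letter alpha) y q.
Proof.
have pow b : exists2 q : seq (letter d), all (fun c => c.1 == i0) q &
    iter k (act_letter alpha (i0, b)) y = foldr (act_letter alpha) y q.
  exists (nseq k (i0, b)); first by rewrite all_nseq eqxx orbT.
  by elim: k => //= k ->.
by rewrite /swap; do 2![case: ifP => _; first exact: pow]; exists [::].
Qed.

Lemma pert_swap_Astar k D : clopen D -> (forall x, D x -> ~ D (iter k S x)) ->
  Astar R d X (perturbation alpha (swap (iter k S) (iter k S') D) i0).
Proof.
move=> cD disjD; apply: pert_Astar => //; first exact: swap_homeo.
  exact: swap_orbit.
move=> mu mualpha; have [cS cS' _ _] := act_letter_homeo act (i0, false).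
by apply: swap_invariant => //; apply: invariant_prob_iter => //; exact: mualpha.
Qed.

(** If [C] does not separate [x] from [y], a point where [C] takes the other value replaces
    whichever of them lies on its side of [B]. *)
Lemma split_pair (Q B C : set X) :
  (exists x y, [/\ Q x, Q y, B x & ~ B y]) ->
  (exists x y, [/\ Q x, Q y, C x & ~ C y]) ->
  exists (e : bool) z z', [/\ Q z, B z & (C z <-> e)] /\
                          [/\ Q z', ~ B z' & (C z' <-> ~~ e)].
Proof.
move=> [x [y [Qx Qy Bx nBy]]] [x' [y' [Qx' Qy' Cx' nCy']]].
have [Cx|nCx] := pselect (C x); have [Cy|nCy] := pselect (C y).
- have [By'|nBy'] := pselect (B y').
    by exists false, y', y; split; split.
  by exists true, x, y'; split; split.
- by exists true, x, y; split; split.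
- by exists false, x, y; split; split.
- have [Bx'|nBx'] := pselect (B x').
    by exists true, x', y; split; split.
  by exists false, x, x'; split; split.
Qed.

Lemma perturb_visit_bound (A : set X) (E : seq (free_group d)) (V : set (X * X)) :
  clopen A -> A !=set0 -> ~` A !=set0 -> entourage V ->
  exists beta, [/\ Astar R d X beta,
    forall s, s \in E -> forall x, V (alpha s x, beta s x) &
    exists m n N K, ~ (visit_bound i0 i1 alpha A m n N K <->
                       visit_bound i0 i1 beta A m n N K)].
Proof.
move=> cA A0 nA0 entV.
have [W entW WP] := pert_close i0 E cX act entV.
have [a Aa] := A0; have [Q [cQ Qa QA QW]] := clopen_small cX hX zX entW cA Aa.
have [oQ _] := cQ; have Q0 : Q !=set0 by exists a.
have [_ _ _ gens] := Aalpha.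
have [minS apS] : minimal S /\ spectrally_aperiodic S.
  by have [[]] := gens i0; rewrite genE.
have [minT apT] : minimal T /\ spectrally_aperiodic T.
  by have [[]] := gens i1; rewrite genE.
have homS := act_letter_homeo act (i0, false).
have homT := act_letter_homeo act (i1, false).
have [cS _ SK S'K] := homS; have [cT _ _ _] := homT.
have [m splitT] := spectrally_aperiodic_splits cX homT minT apT cA A0 nA0 oQ Q0.
have [n splitS] := spectrally_aperiodic_splits cX homS minS apS cA A0 nA0 oQ Q0.
pose B := iter m T @^-1` A; pose C := iter n S @^-1` A.
have cB : clopen B by apply: preimage_clopen => //; exact: continuous_iter.
have cC : clopen C by apply: preimage_clopen => //; exact: continuous_iter.
have [e [z [z' [[Qz Bz Cz] [Qz' nBz' Cz']]]]] := split_pair splitT splitS.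
have cCe (b : bool) : clopen [set x | C x <-> b].
  case: b; first rewrite (_ : [set x | _] = C) //.
    by apply/seteqP; split=> x /=; [case=> _; exact|split].
  rewrite (_ : [set x | _] = ~` C); first exact: clopenC.
  by apply/seteqP; split=> x /=; [move=> -> //|move=> nC; split].
(* Moving a point from [R1] to [R2] flips its membership in [C], and [B] tells the two sets
   apart. *)
pose R1 := Q `&` B `&` [set x | C x <-> e].
pose R2 := Q `&` ~` B `&` [set x | C x <-> ~~ e].
have cR1 : clopen R1 by apply: clopenI (cCe e); exact: clopenI.
have cR2 : clopen R2.
  by apply: clopenI (cCe _); apply: clopenI => //; exact: clopenC.
have [k R2z] : exists k, R2 (iter k S z).
  have [_ /(_ z)[k _ R2k]] := minimal_syndetic cX homS minS (proj1 cR2)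
    (ex_intro _ z' (conj (conj Qz' nBz') Cz')).
  by exists k.
pose D := R1 `&` iter k S @^-1` R2.
have cD : clopen D.
  by apply: clopenI => //; apply: preimage_clopen => //; exact: continuous_iter.
have Dz : D z by split.
have disjD x : D x -> ~ D (iter k S x) by move=> [_ [[_ nB] _]] [[[_ Bx] _] _].
pose h := swap (iter k S) (iter k S') D.
have hQ x : h x = x \/ Q x /\ Q (h x).
  apply: (swapP (homSk k) disjD (P := fun x y => y = x \/ Q x /\ Q y)) => {}x.
  - by move=> [[[Qx _] _] [[Qkx _] _]]; right.
  - move=> [[[Qx _] _] [[]]]; rewrite /preimage /=.
    by have [_ _ _ ->] := homSk k; right.
  - by left.
(* Since [h] only moves points inside [Q], a subset of [A], the outer [h] in the conjugated
   generator does not affect entry into [A]. *)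
have hA x : A (h x) <-> A x.
  have [->//|[/QA Ax /QA Ahx]] := hQ x; by split.
have hh : involutive h by exact: (swapK (homSk k) disjD).
pose beta := perturbation alpha h i0; exists beta; split.
- exact: pert_swap_Astar.
- apply: WP => x; have [->|[Qx Qhx]] := hQ x; first exact: entourage_refl.
  exact: QW.
have [L DL] := minimal_syndetic cX homT minT (proj1 cD) (ex_intro _ z Dz).
have betaT : beta (fgen i1) = T.
  by apply/funext => x; rewrite /beta pert_gen_neq // genE.
have betaS x : iter n (beta (fgen i0)) x = h (iter n S (h x)).
  have -> : beta (fgen i0) = h \o S \o h.
    by apply/funext => y; rewrite /beta pert_gen // genE.
  exact: iter_conj.
pose Ca := double_entry i0 i1 alpha A m n.
pose Cb := double_entry i0 i1 beta A m n.
have CaE x : Ca x <-> B x /\ C x by rewrite /Ca /double_entry /= !genE.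
have CbE x : Cb x <-> B x /\ C (h x).
  rewrite /Cb /double_entry /= betaT betaS.
  by split=> -[Bx /hA].
have hin x : D x -> C (h x) <-> ~~ e.
  by move=> Dx; rewrite /h swap_in //; case: Dx => _ [].
have him x : D (iter k S' x) -> ~ B x /\ (C x <-> ~~ e).
  move=> [_ [[_]]]; rewrite /preimage /=; by have [_ _ _ ->] := homSk k.
have hout x : ~ D x -> ~ D (iter k S' x) -> h x = x by exact: swap_out.
have Din x : D x -> B x /\ (C x <-> e) by move=> [[[]]].
(* The translate of [D] avoids [B], so within [B] only points of [D] are moved. Hence [Ca] and [Cb]
   differ exactly by [D]: it lies in [Ca] if [e] holds and in [Cb] otherwise. *)
have fixed x : B x -> ~ D x -> h x = x.
  by move=> Bx nDx; apply: hout => // /him[].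
have boundE K : visit_bound i0 i1 alpha A m n L.+1 K <->
    forall x, (visits T Ca L.+1 x <= K)%N.
  by rewrite /visit_bound genE.
have boundE' K : visit_bound i0 i1 beta A m n L.+1 K <->
    forall x, (visits T Cb L.+1 x <= K)%N.
  by rewrite /visit_bound betaT.
exists m, n, L.+1.
suff [K [bK nbK]] : exists K,
    (forall x, visits T (if e then Cb else Ca) L.+1 x <= K)%N /\
    ~ (forall x, visits T (if e then Ca else Cb) L.+1 x <= K)%N.
  exists K; case: (e) bK nbK => bK nbK iff; apply: nbK.
    by apply/boundE/iff/boundE'.
  by apply/boundE'/iff/boundE.
apply: (visits_gap a _ _ DL) => x.
  case: (e) hin Din => hin Din; rewrite CaE CbE; split.
  - move=> [Bx Cx]; have [Dx|nDx] := pselect (D x); first by right.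
    by left; rewrite fixed.
  - case=> [[Bx Chx]|/Din[Bx Cx]]; last by split=> //; exact/Cx.
    split=> //; have [/hin hD|nDx] := pselect (D x); first by move/hD: Chx.
    by rewrite -(fixed x).
  - move=> [Bx Chx]; have [Dx|nDx] := pselect (D x); first by right.
    by left; rewrite fixed // in Chx.
  - case=> [[Bx Cx]|Dx]; last by split; [case: (Din x Dx)|apply/(hin x Dx)].
    split=> //; have [/Din[_ nC]|nDx] := pselect (D x); first by move/nC: Cx.
    by rewrite fixed.
case: (e) hin Din => hin Din.
  by move=> /CbE[_ Chx] Dx; move/(hin x Dx): Chx.
by move=> /CaE[_ Cx] /Din[_ nC]; move/nC: Cx.
Qed.

End Perturb.

(** * Nowhere dense pieces of a conjugation orbit *)

Lemma set_type_nbhsP (T : topologicalType) (S : set T) (x : set_type S)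
    (O : set (set_type S)) :
  nbhs x O <-> exists2 U : set T, nbhs (set_val x) U & set_val @^-1` U `<=` O.
Proof.
split=> [[_ [[U oU <-] Ux UO]]|[U nU UO]].
  by exists U => //; exact: open_nbhs_nbhs.
by apply: filterS UO _; exact: (@initial_continuous _ _ set_val x U nU).
Qed.

(** If the closure had interior, some [b0] of [F] would lie there, and a perturbation [b1] of it
    with a different bound as well. Members of [F] close to [b1] share its bound, contrary to the
    agreement with [b0]. *)
Lemma same_visit_bounds_nowhere_dense (R : realType) (d : nat)
    (X : puniformType) (i0 i1 : 'I_d) (A : set X)
    (F : set (set_type (Astar R d X))) :
  compact [set: X] -> hausdorff_space X -> zero_dimensional X -> i1 != i0 ->
  clopen A -> A !=set0 -> ~` A !=set0 ->
  (forall b c, F b -> F c -> forall m n N K,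
     visit_bound i0 i1 (set_val b) A m n N K <->
     visit_bound i0 i1 (set_val c) A m n N K) ->
  nowhere_dense F.
Proof.
move=> cX hX zX i01 cA A0 nA0 F_same; apply/seteqP; split=> // b Ob.
have valA (c : set_type (Astar R d X)) : Astar R d X (set_val c) by exact: set_valP.
have [b0 [Fb0 Ob0]] :=
  interior_subset Ob _ (open_nbhs_nbhs (conj (@open_interior _ _) Ob)).
have /set_type_nbhsP[U /elementwise_nbhsP[E [V [entV EVU]]] UO] :
  nbhs b0 (interior (closure F)) by exact: open_nbhs_nbhs (conj (@open_interior _ _) Ob0).
have [beta [Abeta near [m [n [N [K differ]]]]]] :=
  perturb_visit_bound cX hX zX i01 (valA b0) E cA A0 nA0 entV.
pose b1 : set_type (Astar R d X) := exist _ beta (mem_set Abeta).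
have /interior_subset clb1 : interior (closure F) b1 by apply: UO; exact: EVU.
have actbeta : Act d X beta by have [] := Abeta.
have nb1 : nbhs b1 (set_val @^-1` [set c | Act d X c ->
    (visit_bound i0 i1 beta A m n N K <-> visit_bound i0 i1 c A m n N K)]).
  apply/set_type_nbhsP; eexists; last exact: subset_refl.
  exact: visit_bound_near.
have [c [Fc /= vc]] := clb1 _ nb1.
have actc : Act d X (set_val c) by case: (valA c).
apply: differ; apply: iff_trans (iff_sym (vc actc)).
exact: F_same.
Qed.

(* [cantor_space] carries no pseudometric structure in the library; this copy
   does, and has the same topology. *)
Definition metric_cantor_space : Type := prod_topology (fun _ : nat => bool).

HB.instance Definition _ := Pointed.copy metric_cantor_space cantor_space.
HB.instance Definition _ (R : realType) :=
  PseudoMetric.copy metric_cantor_space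
    (prod_topology (fun _ : nat => bool : pseudoMetricType R)).

Lemma cantor_clopen_countable (R : realType) : countable (@clopen cantor_space).
Proof.
apply: clopen_countable; first exact: cantor_space_compact.
exact: (@compact_second_countable R metric_cantor_space cantor_space_compact).
Qed.

Lemma cantor_proper_clopen :
  exists A : set cantor_space, [/\ clopen A, A !=set0 & ~` A !=set0].
Proof.
have tf : (fun=> true : bool) != (fun=> false) :> cantor_space.
  by apply/eqP => /(congr1 (fun f => f 0%N)).
have [A [cA At Af]] := cantor_zero_dimensional tf.
by exists A; split=> //; [exists (fun=> true)|exists (fun=> false)].
Qed.

Theorem theorem5 (R : realType) (d : nat) (hd : (2 <= d)%N)
    (alpha : set_type (Astar R d cantor_space)) :
  meagre [set beta : set_type (Astar R d cantor_space) |
            conj_orbit (set_val alpha) (set_val beta)].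
Proof.
pose i0 : 'I_d := Ordinal (ltnW hd); pose i1 : 'I_d := Ordinal hd.
have [A [cA [a Aa] [a' nAa']]] := cantor_proper_clopen.
have /countable_injP[code code_inj] := cantor_clopen_countable R.
(* The orbit is cut according to the image of [A] under the conjugating map, which is one of
   countably many clopen sets. *)
pose F k : set (set_type (Astar R d cantor_space)) := [set beta |
  exists g h : cantor_space -> cantor_space, [/\ homeo_with_inverse g h,
    forall s x, set_val beta s x = g (set_val alpha s (h x)) &
    code (h @^-1` A) = k]].
have cpre (h : cantor_space -> cantor_space) : continuous h -> clopen (h @^-1` A).
  by move=> ch; exact: preimage_clopen.
exists F; split=> [k|]; last first.
  apply/seteqP; split=> [beta [g [h [hom gh]]]|beta [k _ [g [h [hom gh _]]]]].
    by exists (code (h @^-1` A)) => //; exists g, h.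
  by exists g, h.
have [[b0 [g [h [hom gh hk]]]]|F0] := pselect (exists b, F k b); last first.
  apply: (@same_visit_bounds_nowhere_dense _ _ _ i0 i1 A) => //.
  - exact: cantor_space_compact.
  - exact: cantor_space_hausdorff.
  - exact: cantor_zero_dimensional.
  - by exists a.
  - by exists a'.
  - by move=> b c Fb; case: F0; exists b.
have [cg ch gK hK] := hom.
apply: (@same_visit_bounds_nowhere_dense _ _ _ i0 i1 (h @^-1` A)) => //.
- exact: cantor_space_compact.
- exact: cantor_space_hausdorff.
- exact: cantor_zero_dimensional.
- exact: cpre.
- by exists (g a); rewrite /preimage /= gK.
- by exists (g a'); rewrite /preimage /= gK.
(* Injectivity of [code] gives all members of the piece the same image of [A], where their bounds
   are those of [alpha] for [A]. *)
have FE b : F k b -> forall m n N K,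
    visit_bound i0 i1 (set_val b) (h @^-1` A) m n N K <->
    visit_bound i0 i1 (set_val alpha) A m n N K.
  move=> [g' [h' [hom' gh' hk']]] m n N K.
  have -> : h @^-1` A = h' @^-1` A.
    have [_ ch' _ _] := hom'.
    by apply: code_inj; rewrite ?inE ?hk' //; exact: cpre.
  exact: visit_bound_conj hom' gh'.
by move=> b c Fb Fc m n N K; rewrite !FE.
Qed.
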